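(* Let $\mathcal D=(D,<,\rho)$ be a computable partially ordered set. 1. Suppose $(D,<)$ contains arbitrarily large finite chains (for every $k$ there is a chain with $k$ elements). Then $K^{\mathcal D}_{\max}$ and $K^{\mathcal D}_{\min}$ are $\le_{ct}$-incomparable and both are $<_{ct}K^D$. More strongly, for every total computable $\alpha:\mathbb N\to\mathbb N$ the following four sets are infinite: $\{d\in D:K^{\mathcal D}_{\max}(d)\ge\alpha(K^{\mathcal D}_{\min}(d))\}$, $\{d\in D:K^D(d)\ge\alpha(K^{\mathcal D}_{\min}(d))\}$, $\{d\in D:K^{\mathcal D}_{\min}(d)\ge\alpha(K^{\mathcal D}_{\max}(d))\}$, $\{d\in D:K^D(d)\ge\alpha(K^{\mathcal D}_{\max}(d))\}$. 2. If $(D,<)$ does not contain arbitrarily large finite chains, then $K^{\mathcal D}_{\min}=_{ct}K^{\mathcal D}_{\max}=_{ct}K^D$.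
   Context: A computable partially ordered set is a triple $\mathcal D=(D,<,\rho)$ where $\rho:\mathbb N\to D$ is a bijection and $<$ is a strict partial order on $D$ such that $\{(m,n):\rho(m)<\rho(n)\}$ is computable; a partial function into $D$ is partial (resp. total) computable if its composition with $\rho^{-1}$ is. For a partial $f:\{0,1\}^*\times\mathbb N\to D$ monotone increasing in its second argument on its domain, $\max^{\mathcal D}f$ is the partial function defined exactly at those $p$ for which $\{f(p,t):t\in\mathbb N,\ f(p,t)\text{ defined}\}$ is finite and non-empty, with value its maximum element. $\mathrm{Max}_{\mathrm{PR}}[\{0,1\}^*\to\mathcal D]$ is the class of all $\max^{\mathcal D}f$ with $f$ partial computable and monotone increasing in its second argument. For partial $\varphi:\{0,1\}^*\to D$, $K_\varphi(d)=\min\{|p|:\varphi(p)=d\}$. $K^D$ is $K_\varphi$ for $\varphi$ optimal among partial computable functions $\{0,1\}^*\to D$ (for every partial computable $\psi$ there is $c$ with $K_\varphi(d)\le K_\psi(d)+c$ whenever $K_\psi(d)$ is defined). $K^{\mathcal D}_{\max}$ is $K_U$ for some $U$ optimal in the same sense within $\mathrm{Max}_{\mathrm{PR}}[\{0,1\}^*\to\mathcal D]$ (such $U$ exists), and $K^{\mathcal D}_{\min}$ is $K^{\mathcal D'}_{\max}$ for the reverse order $\mathcal D'=(D,>,\rho)$. These are total functions $D\to\mathbb N$ defined up to an additive constant. $f\le_{ct}g$ iff $\exists c\,\forall d\ f(d)\le g(d)+c$; $f=_{ct}g$ iff $f\le_{ct}g$ and $g\le_{ct}f$; $f<_{ct}g$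 iff $f\le_{ct}g$ and not $g\le_{ct}f$. *)

(* Defs.v *)
(* Computability is modelled by an explicit inductive class of
   mu-recursive functions (unary, via Cantor pairing) with relational semantics. *)
From Stdlib Require Import List Arith ClassicalEpsilon.
Import ListNotations.

Definition npair (a b : nat) : nat := (a + b) * (a + b + 1) / 2 + b.

Inductive code : Type :=
| cZero : code
| cSucc : code
| cId   : code
| cFst  : code
| cSnd  : code
| cPair : code -> code -> code
| cComp : code -> code -> code
| cRec  : code -> code -> code
| cMu   : code -> code.

Inductive eval : code -> nat -> nat -> Prop :=
| ev_zero x : eval cZero x 0
| ev_succ x : eval cSucc x (S x)
| ev_id x : eval cId x x
| ev_fst a b : eval cFst (npair a b) a
| ev_snd a b : eval cSnd (npair a b) b
| ev_pair f g x a b : eval f x a -> eval g x b -> eval (cPair f g) x (npair a b)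
| ev_comp f g x y z : eval g x y -> eval f y z -> eval (cComp f g) x z
| ev_rec0 f g x y : eval f x y -> eval (cRec f g) (npair x 0) y
| ev_recS f g x n y z : eval (cRec f g) (npair x n) y ->
    eval g (npair x (npair n y)) z -> eval (cRec f g) (npair x (S n)) z
| ev_mu f x n : eval f (npair x n) 0 ->
    (forall m, m < n -> exists k, eval f (npair x m) (S k)) -> eval (cMu f) x n.

Definition pc_nat (g : nat -> option nat) : Prop :=
  exists c, forall x y, eval c x y <-> g x = Some y.

Definition total_computable (a : nat -> nat) : Prop :=
  pc_nat (fun x => Some (a x)).

(* bijective binary numeration {0,1}^* -> N *)
Fixpoint bcode (s : list bool) : nat :=
  match s with
  | [] => 0
  | b :: s' => S (2 * bcode s' + (if b then 1 else 0))
  end.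

Definition strict_po {D : Type} (lt : D -> D -> Prop) : Prop :=
  (forall x, ~ lt x x) /\ (forall x y z, lt x y -> lt y z -> lt x z).

Definition bij_nat {D : Type} (rho : nat -> D) : Prop :=
  (forall m n, rho m = rho n -> m = n) /\ (forall d, exists n, rho n = d).

Definition computable_poset {D : Type} (lt : D -> D -> Prop) (rho : nat -> D) : Prop :=
  strict_po lt /\ bij_nat rho /\
  exists chi : nat -> nat, total_computable chi /\
    (forall m n, chi (npair m n) = 1 <-> lt (rho m) (rho n)) /\
    (forall z, chi z = 0 \/ chi z = 1).

Definition pc_fun {D : Type} (rho : nat -> D) (phi : list bool -> option D) : Prop :=
  exists g, pc_nat g /\ forall p, phi p = option_map rho (g (bcode p)).

Definition pc_fun2 {D : Type} (rho : nat -> D) (f : list bool -> nat -> option D) : Prop :=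
  exists g, pc_nat g /\ forall p t, f p t = option_map rho (g (npair (bcode p) t)).

Definition leD {D : Type} (lt : D -> D -> Prop) (x y : D) : Prop := x = y \/ lt x y.

Definition monotone2 {D : Type} (lt : D -> D -> Prop) (f : list bool -> nat -> option D) : Prop :=
  forall p t t' x x', t <= t' -> f p t = Some x -> f p t' = Some x' -> leD lt x x'.

Definition is_maxD {D : Type} (lt : D -> D -> Prop) (f : list bool -> nat -> option D)
  (p : list bool) (d : D) : Prop :=
  (exists l : list D, forall x, (exists t, f p t = Some x) -> In x l) /\
  (exists t, f p t = Some d) /\
  (forall x, (exists t, f p t = Some x) -> leD lt x d).

Definition MaxPR {D : Type} (lt : D -> D -> Prop) (rho : nat -> D)
  (phi : list bool -> option D) : Prop :=
  exists f, pc_fun2 rho f /\ monotone2 lt f /\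
    forall p d, phi p = Some d <-> is_maxD lt f p d.

(* K_phi(d) = min {|p| : phi p = d}; (value 0 if undefined, which never happens
   for the optimal functions considered) *)
Definition isK {D : Type} (phi : list bool -> option D) (d : D) (n : nat) : Prop :=
  (exists p, phi p = Some d /\ length p = n) /\
  (forall p, phi p = Some d -> n <= length p).

Definition K {D : Type} (phi : list bool -> option D) (d : D) : nat :=
  match excluded_middle_informative (exists n, isK phi d n) with
  | left H => proj1_sig (constructive_indefinite_description _ H)
  | right _ => 0
  end.

Definition Kdefined {D : Type} (phi : list bool -> option D) (d : D) : Prop :=
  exists p, phi p = Some d.

Definition optimal {D : Type} (C : (list bool -> option D) -> Prop)
  (phi : list bool -> option D) : Prop :=
  C phi /\
  forall psi, C psi -> exists c, forall d,
    Kdefined psi d -> Kdefined phi d /\ K phi d <= K psi d + c.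

Definition le_ct {D : Type} (f g : D -> nat) : Prop :=
  exists c, forall d, f d <= g d + c.
Definition eq_ct {D : Type} (f g : D -> nat) : Prop := le_ct f g /\ le_ct g f.
Definition lt_ct {D : Type} (f g : D -> nat) : Prop := le_ct f g /\ ~ le_ct g f.

Definition infinite_set {D : Type} (P : D -> Prop) : Prop :=
  forall l : list D, exists d, P d /\ ~ In d l.

Definition arb_large_chains {D : Type} (lt : D -> D -> Prop) : Prop :=
  forall k, exists l : list D, length l = k /\ NoDup l /\
    forall x y, In x l -> In y l -> leD lt x y \/ lt y x.

(* Main.v *)
Require Import Defs.
From Stdlib Require Import List Arith Lia ClassicalEpsilon.
From Stdlib Require Cantor.
Import ListNotations.

(** A value of a function in [MaxPR] is the limit of a computable increasing approximation.

    If chains have fewer than [k] elements, such an approximation changes fewer than [k] times,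
    and waiting for its [j]-th change is a partial computable function for each [j < k]; these
    finitely many functions cover all values, so [K phi] is bounded by [K Umax].

    If chains are arbitrarily long, fix a descending chain longer than the number of programs
    of length below [A (2 n)], with [A] a computable monotone majorant of [alpha], and walk down
    it, leaving an element as soon as one of these programs points at it. The approximations
    increase while the walk descends, so each program causes at most one move and the walk stops
    at some [d] with [K Umax d >= A (2 n)]. As the limit of a decreasing computable sequence
    depending on [n], [d] has [K Umin d <= n + c <= 2 n] for [n >= c]. *)

(** * Projections of the Cantor pairing *)

Definition nfst (z : nat) : nat := fst (Cantor.of_nat z).
Definition nsnd (z : nat) : nat := snd (Cantor.of_nat z).

Lemma npair_to_nat a b : npair a b = Cantor.to_nat (a, b).
Proof.
  pose proof (Cantor.to_nat_spec a b) as H. unfold npair.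
  replace ((a + b) * (a + b + 1)) with ((Cantor.to_nat (a, b) - b) * 2) by nia.
  rewrite Nat.div_mul by lia. nia.
Qed.

Lemma nfst_npair a b : nfst (npair a b) = a.
Proof. unfold nfst. now rewrite npair_to_nat, Cantor.cancel_of_to. Qed.

Lemma nsnd_npair a b : nsnd (npair a b) = b.
Proof. unfold nsnd. now rewrite npair_to_nat, Cantor.cancel_of_to. Qed.

Lemma npair_eta z : npair (nfst z) (nsnd z) = z.
Proof.
  unfold nfst, nsnd. rewrite npair_to_nat, <- surjective_pairing.
  apply Cantor.cancel_to_of.
Qed.

Lemma npair_inj a b a' b' : npair a b = npair a' b' -> a = a' /\ b = b'.
Proof.
  intros H. split.
  - rewrite <- (nfst_npair a b), H. apply nfst_npair.
  - rewrite <- (nsnd_npair a b), H. apply nsnd_npair.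
Qed.

(** * Closure properties of total computable functions *)

Definition code_total (f : nat -> nat) : Prop := exists c, forall x, eval c x (f x).

Lemma ct_ext f g : (forall x, f x = g x) -> code_total f -> code_total g.
Proof. intros E [c H]. exists c. intros x. rewrite <- E. apply H. Qed.

Lemma ct_id : code_total (fun x => x).
Proof. exists cId. constructor. Qed.

Lemma ct_comp f g : code_total f -> code_total g -> code_total (fun x => f (g x)).
Proof.
  intros [c H] [c' H']. exists (cComp c c'). intros x. econstructor; [apply H'|apply H].
Qed.

Lemma ct_succ f : code_total f -> code_total (fun x => S (f x)).
Proof. apply (ct_comp S). exists cSucc. constructor. Qed.

Lemma ct_nfst f : code_total f -> code_total (fun x => nfst (f x)).
Proof.
  apply (ct_comp nfst). exists cFst. intros x. rewrite <- (npair_eta x) at 1. constructor.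
Qed.

Lemma ct_nsnd f : code_total f -> code_total (fun x => nsnd (f x)).
Proof.
  apply (ct_comp nsnd). exists cSnd. intros x. rewrite <- (npair_eta x) at 1. constructor.
Qed.

Lemma ct_npair f g : code_total f -> code_total g -> code_total (fun x => npair (f x) (g x)).
Proof. intros [c H] [c' H']. exists (cPair c c'). intros x. now constructor. Qed.

Lemma ct_const n : code_total (fun _ => n).
Proof. induction n. - exists cZero. constructor. - now apply ct_succ. Qed.

(** Codes are unary, so computability of the ternary [st] is stated after unpacking the nested pair
    [npair x (npair n y)] that [cRec] passes to its step. The parameter [x] stays available in every
    round. *)
Lemma ct_rec a st m :
  code_total a -> code_total (fun z => st (nfst z) (nfst (nsnd z)) (nsnd (nsnd z))) ->
  code_total m -> code_total (fun x => nat_rect (fun _ => nat) (a x) (st x) (m x)).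
Proof.
  intros [ca Ha] [cs Hs] [cm Hm]. exists (cComp (cRec ca cs) (cPair cId cm)).
  intros x. apply ev_comp with (npair x (m x)); [now repeat constructor|].
  induction (m x) as [|n IH]; simpl; [now constructor|].
  eapply ev_recS; [exact IH|].
  specialize (Hs (npair x (npair n (nat_rect (fun _ => nat) (a x) (st x) n)))).
  now rewrite ?nsnd_npair, ?nfst_npair in Hs.
Qed.

(** With [0] for no value and [S y] for the value [y], this serves below as the bind of partial
    results. *)
Definition ncase {A : Type} (r : nat) (a : A) (b : nat -> A) : A :=
  match r with 0 => a | S y => b y end.

Lemma ct_ncase r a b :
  code_total r -> code_total a -> code_total (fun z => b (nfst z) (nsnd z)) ->
  code_total (fun x => ncase (r x) (a x) (b x)).
Proof.
  intros Hr Ha Hb.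
  apply ct_ext with (fun x => nat_rect (fun _ => nat) (a x) (fun m _ => b x m) (r x)).
  { intros x. now destruct (r x). }
  apply (ct_rec a (fun x m _ => b x m) r); auto.
  apply ct_ext with (fun z => (fun u => b (nfst u) (nsnd u)) (npair (nfst z) (nfst (nsnd z)))).
  { intros z. now rewrite nfst_npair, nsnd_npair. }
  apply (ct_comp (fun u => b (nfst u) (nsnd u))); auto.
  auto using ct_npair, ct_nfst, ct_nsnd, ct_id.
Qed.

Lemma ct_add f g : code_total f -> code_total g -> code_total (fun x => f x + g x).
Proof.
  intros Hf Hg.
  apply ct_ext with (fun x => nat_rect (fun _ => nat) (g x) (fun _ r => S r) (f x)).
  { intros x. now induction (f x); simpl; f_equal. }
  apply (ct_rec g (fun _ _ r => S r) f); auto using ct_succ, ct_nsnd, ct_id.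
Qed.

Lemma ct_pred f : code_total f -> code_total (fun x => pred (f x)).
Proof.
  intros Hf. apply ct_ext with (fun x => ncase (f x) 0 (fun y => y)).
  { intros x. now destruct (f x). }
  apply (ct_ncase f (fun _ => 0) (fun _ y => y)); auto using ct_const, ct_nsnd, ct_id.
Qed.

Lemma ct_sub f g : code_total f -> code_total g -> code_total (fun x => f x - g x).
Proof.
  intros Hf Hg.
  apply ct_ext with (fun x => nat_rect (fun _ => nat) (f x) (fun _ r => pred r) (g x)).
  { intros x. induction (g x); simpl; lia. }
  apply (ct_rec f (fun _ _ r => pred r) g); auto using ct_pred, ct_nsnd, ct_id.
Qed.

Lemma ct_ifeq a b u v :
  code_total a -> code_total b -> code_total u -> code_total v ->
  code_total (fun x => if Nat.eqb (a x) (b x) then u x else v x).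
Proof.
  intros Ha Hb Hu Hv.
  apply ct_ext with (fun x => ncase ((a x - b x) + (b x - a x)) (u x) (fun _ => v x)).
  { intros x. destruct (Nat.eqb_spec (a x) (b x)) as [->|N].
    - now rewrite Nat.sub_diag.
    - destruct (a x - b x + (b x - a x)) eqn:E; [lia|reflexivity]. }
  apply (ct_ncase (fun x => (a x - b x) + (b x - a x)) u (fun x _ => v x));
    auto using ct_add, ct_sub.
  apply (ct_comp v); auto using ct_nfst, ct_id.
Qed.

(** The patterns [@?f x] extract the component functions from the goal, so that each closure lemma
    is applied with explicit arguments instead of by higher-order unification. *)
Ltac ct :=
  repeat (cbv beta;
  match goal with
  | H : code_total ?f |- code_total ?f => exact H
  | |- code_total (fun x => x) => apply ct_id
  | |- code_total (fun _ => ?n) => apply (ct_const n)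
  | |- code_total (fun x => S (@?f x)) => apply (ct_succ f)
  | |- code_total (fun x => pred (@?f x)) => apply (ct_pred f)
  | |- code_total (fun x => nfst (@?f x)) => apply (ct_nfst f)
  | |- code_total (fun x => nsnd (@?f x)) => apply (ct_nsnd f)
  | |- code_total (fun x => npair (@?f x) (@?g x)) => apply (ct_npair f g)
  | |- code_total (fun x => (@?f x) + (@?g x)) => apply (ct_add f g)
  | |- code_total (fun x => if Nat.eqb (@?a x) (@?b x) then @?u x else @?v x) =>
      apply (ct_ifeq a b u v)
  | |- code_total (fun x => ncase (@?r x) (@?a x) (@?b x)) => apply (ct_ncase r a b)
  | |- code_total (fun x => nat_rect _ (@?a x) (@?st x) (@?m x)) => apply (ct_rec a st m)
  | H : code_total ?f |- code_total (fun x => ?f (@?g x)) => apply (ct_comp f g H)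
  end).

(** * Step-bounded approximations of evaluation *)

Definition eventually (P : nat -> Prop) : Prop := exists s0, forall s, s0 <= s -> P s.

Lemma eventually_always (P : nat -> Prop) : (forall s, P s) -> eventually P.
Proof. exists 0. auto. Qed.

Lemma eventually_impl (P Q : nat -> Prop) :
  (forall s, P s -> Q s) -> eventually P -> eventually Q.
Proof. intros H [s0 H0]. exists s0. auto. Qed.

Lemma eventually_and (P Q : nat -> Prop) :
  eventually P -> eventually Q -> eventually (fun s => P s /\ Q s).
Proof.
  intros [s1 H1] [s2 H2]. exists (s1 + s2). intros s Hs. split; [apply H1|apply H2]; lia.
Qed.

Lemma eventually_forall_lt (P : nat -> nat -> Prop) n :
  (forall m, m < n -> eventually (P m)) -> eventually (fun s => forall m, m < n -> P m s).
Proof.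
  induction n as [|n IH]; intros H.
  - exists 0. intros; lia.
  - assert (E : eventually (fun s => (forall m, m < n -> P m s) /\ P n s))
      by (apply eventually_and; auto).
    revert E. apply eventually_impl. intros s [H1 H2] m Hm.
    destruct (Nat.eq_dec m n) as [->|]; [auto|apply H1; lia].
Qed.

(* [st (npair x s)] is [0] while [c] has not been seen to halt on [x] within budget [s],
   and [S y] once the output [y] has been seen. *)
Definition step_approx (c : code) (st : nat -> nat) : Prop :=
  code_total st /\
  (forall x s y, st (npair x s) = S y -> eval c x y) /\
  (forall x y, eval c x y -> eventually (fun s => st (npair x s) = S y)).

(** Uniqueness of the output is a hypothesis because determinism of [eval] is itself derived from
    these approximations. *)
Lemma step_approx_total c f :
  (forall x, eval c x (f x)) -> (forall x y, eval c x y -> y = f x) ->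
  step_approx c (fun z => S (f (nfst z))).
Proof.
  intros H1 H2. split; [|split].
  - assert (code_total f) by now exists c. ct.
  - intros x s y. rewrite nfst_npair. injection 1 as <-. auto.
  - intros x y H. apply eventually_always. intros s. now rewrite nfst_npair, (H2 x y).
Qed.

Lemma step_approx_pair f g stf stg :
  step_approx f stf -> step_approx g stg ->
  step_approx (cPair f g)
    (fun z => ncase (stf z) 0 (fun a => ncase (stg z) 0 (fun b => S (npair a b)))).
Proof.
  intros (Tf & Sf & Cf) (Tg & Sg & Cg). split; [|split].
  - ct.
  - intros x s y. destruct (stf _) eqn:Ef; [discriminate|].
    destruct (stg _) eqn:Eg; [discriminate|]. simpl. injection 1 as <-. constructor; eauto.
  - intros x y H. inversion H; subst.
    eapply eventually_impl; [|apply eventually_and; [apply Cf|apply Cg]; eassumption].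
    intros s [Ef Eg]. cbv beta in *. rewrite Ef. simpl. now rewrite Eg.
Qed.

Lemma step_approx_comp f g stf stg :
  step_approx f stf -> step_approx g stg ->
  step_approx (cComp f g) (fun z => ncase (stg z) 0 (fun y => stf (npair y (nsnd z)))).
Proof.
  intros (Tf & Sf & Cf) (Tg & Sg & Cg). split; [|split].
  - ct.
  - intros x s y. rewrite nsnd_npair. destruct (stg _) eqn:Eg; [discriminate|].
    simpl. intros H. econstructor; eauto.
  - intros x z H. inversion H; subst.
    eapply eventually_impl; [|apply eventually_and; [eapply Cg; eassumption|eapply Cf; eassumption]].
    intros s [Eg Ef]. cbv beta in *. now rewrite nsnd_npair, Eg.
Qed.

Lemma step_approx_rec f g stf stg :
  step_approx f stf -> step_approx g stg ->
  step_approx (cRec f g) (fun z => nat_rect (fun _ => nat)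
    (stf (npair (nfst (nfst z)) (nsnd z)))
    (fun m r => ncase r 0 (fun y => stg (npair (npair (nfst (nfst z)) (npair m y)) (nsnd z))))
    (nsnd (nfst z))).
Proof.
  intros (Tf & Sf & Cf) (Tg & Sg & Cg). split; [|split].
  - ct.
  - intros x s. rewrite <- (npair_eta x), !nfst_npair, !nsnd_npair.
    induction (nsnd x) as [|n IH]; simpl; intros y H.
    + constructor. eauto.
    + destruct (nat_rect _ _ _ n) eqn:E; [discriminate|].
      simpl in H. econstructor; eauto.
  - intros x. rewrite <- (npair_eta x).
    induction (nsnd x) as [|n IH]; intros y H; inversion H; subst;
      match goal with E : npair _ _ = npair _ _ |- _ =>
        apply npair_inj in E; destruct E as [-> E]; try discriminate E end.
    + eapply eventually_impl; [|eapply Cf; eassumption].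
      intros s E'. cbv beta. now rewrite !nfst_npair, !nsnd_npair.
    + match goal with E : S _ = S _ |- _ => injection E as -> end.
      eapply eventually_impl;
        [|apply eventually_and; [eapply IH; eassumption|eapply Cg; eassumption]].
      intros s [E1 E2]. cbv beta in *. rewrite !nfst_npair, !nsnd_npair in *.
      simpl. now rewrite E1.
Qed.

(* State of the bounded search: [0] still searching, [1] blocked on a value that has not
   converged yet, [S (S m)] when [m] has been found. *)
Lemma step_approx_mu f stf :
  step_approx f stf ->
  step_approx (cMu f) (fun z => pred (nat_rect (fun _ => nat) 0
    (fun m r => ncase r
       (ncase (stf (npair (npair (nfst z) m) (nsnd z))) 1
          (fun v => ncase v (S (S m)) (fun _ => 0)))
       (fun r' => S r'))
    (nsnd z))).
Proof.
  intros (Tf & Sf & Cf). split; [|split].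
  - ct.
  - intros x s y. rewrite !nfst_npair, !nsnd_npair.
    set (r := nat_rect _ _ _).
    (* State [0] must certify that every argument tried so far gave a positive value; this is the
       side condition of [ev_mu] when a zero is found next. *)
    assert (inv : forall k, (r k = 0 -> forall m, m < k -> exists v, eval f (npair x m) (S v)) /\
                            (forall m, r k = S (S m) -> eval (cMu f) x m)).
    { induction k as [|k [IH1 IH2]].
      - split; [intros; lia|discriminate].
      - change (r (S k)) with (ncase (r k)
          (ncase (stf (npair (npair x k) s)) 1 (fun v => ncase v (S (S k)) (fun _ => 0)))
          (fun r' => S r')).
        destruct (r k) as [|r'] eqn:Er; simpl.
        + destruct (stf _) as [|[|v]] eqn:Ev; simpl; (split; [intros E|intros m E]);
            try discriminate E.
          * injection E as <-. constructor; eauto.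
          * intros m Hm. destruct (Nat.eq_dec m k) as [->|]; [eauto|apply IH1; auto; lia].
        + split; [discriminate|]. exact IH2. }
    intros E. apply (proj2 (inv s)). destruct (r s) as [|k]; simpl in E; congruence.
  - intros x n H. inversion H as [| | | | | | | | |? ? ? H0 HS]; subst.
    assert (E : eventually (fun s => forall m, m < n -> exists k, stf (npair (npair x m) s) = S (S k))).
    { apply eventually_forall_lt. intros m Hm. destruct (HS m Hm) as [k Hk].
      eapply eventually_impl; [|eapply Cf, Hk]. intros s E. now exists k. }
    (* The budget also limits the number of rounds, so besides the convergence of all values up to
       [n] it must be at least [S n]. *)
    eapply eventually_impl; [|apply eventually_and; [exact E|
      apply eventually_and; [eapply Cf, H0|exists (S n); exact (fun s Hs => Hs)]]].
    clear E. intros s (E1 & E2 & Hs). cbv beta in *. rewrite !nfst_npair, !nsnd_npair.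
    set (r := nat_rect _ _ _).
    assert (rS : forall k, r (S k) = ncase (r k)
          (ncase (stf (npair (npair x k) s)) 1 (fun v => ncase v (S (S k)) (fun _ => 0)))
          (fun r' => S r')) by reflexivity.
    assert (R0 : forall k, k <= n -> r k = 0).
    { induction k as [|k IH]; intros Hk; [reflexivity|].
      rewrite rS, IH by lia. destruct (E1 k Hk) as [v ->]. reflexivity. }
    assert (R1 : forall k, S n <= k -> r k = S (S n)).
    { induction 1 as [|k Hk IH].
      - rewrite rS, R0 by lia. now rewrite E2.
      - now rewrite rS, IH. }
    now rewrite R1.
Qed.

Lemma step_approx_exists c : exists st, step_approx c st.
Proof.
  induction c as [| | | | |f [sf Hf] g [sg Hg]|f [sf Hf] g [sg Hg]|f [sf Hf] g [sg Hg]|f [sf Hf]].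
  - eexists. apply (step_approx_total cZero (fun _ => 0)); [constructor|now inversion 1].
  - eexists. apply (step_approx_total cSucc S); [constructor|now inversion 1].
  - eexists. apply (step_approx_total cId (fun x => x)); [constructor|now inversion 1].
  - eexists. apply (step_approx_total cFst nfst).
    + intros x. rewrite <- (npair_eta x) at 1. constructor.
    + inversion 1; subst. now rewrite nfst_npair.
  - eexists. apply (step_approx_total cSnd nsnd).
    + intros x. rewrite <- (npair_eta x) at 1. constructor.
    + inversion 1; subst. now rewrite nsnd_npair.
  - eexists. apply step_approx_pair; eassumption.
  - eexists. apply step_approx_comp; eassumption.
  - eexists. apply step_approx_rec; eassumption.
  - eexists. apply step_approx_mu; eassumption.
Qed.

(** * Determinism of evaluation and unbounded search *)

Lemma eval_det c x y y' : eval c x y -> eval c x y' -> y = y'.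
Proof.
  intros H H'. destruct (step_approx_exists c) as (st & _ & _ & C).
  (* At a large enough budget the single function [st] shows both outputs at once. *)
  destruct (eventually_and _ _ (C _ _ H) (C _ _ H')) as [s Hs].
  destruct (Hs s (le_n _)). congruence.
Qed.

Lemma pc_nat_of_code c : exists g, (forall x y, eval c x y <-> g x = Some y).
Proof.
  exists (fun x => match excluded_middle_informative (exists y, eval c x y) with
    | left H => Some (proj1_sig (constructive_indefinite_description _ H))
    | right _ => None end).
  intros x y. destruct (excluded_middle_informative _) as [H|H].
  - destruct (constructive_indefinite_description _ H) as [y' Hy']. simpl. split.
    + intros E. f_equal. eapply eval_det; eassumption.
    + now injection 1 as <-.
  - split; [intros E; elim H; eauto|discriminate].
Qed.

Lemma total_computable_code f : total_computable f <-> code_total f.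
Proof.
  split.
  - intros [c H]. exists c. intros x. now apply H.
  - intros [c H]. exists c. intros x y. split.
    + intros E. f_equal. eapply eval_det; eauto.
    + injection 1 as <-. auto.
Qed.

Lemma pc_nat_comp g f : pc_nat g -> code_total f -> pc_nat (fun x => g (f x)).
Proof.
  intros [c H] [c' H']. exists (cComp c c'). intros x y. rewrite <- H. split.
  - inversion 1; subst. erewrite (eval_det c' x (f x)); eauto.
  - intros E. econstructor; eauto.
Qed.

Lemma least_nat (Q : nat -> Prop) :
  (exists n, Q n) -> exists n, Q n /\ forall m, m < n -> ~ Q m.
Proof.
  intros [n Hn]. induction n as [n IH] using lt_wf_ind.
  destruct (excluded_middle_informative (exists m, m < n /\ Q m)) as [(m & Hm & Q')|N].
  - eauto.
  - exists n. split; auto. intros m Hm Q'. apply N. eauto.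
Qed.

Lemma eval_mu_total c P x n :
  (forall z, eval c z (P z)) -> P (npair x n) = 0 ->
  (forall m, m < n -> P (npair x m) <> 0) -> eval (cMu c) x n.
Proof.
  intros H H0 HS. constructor.
  - rewrite <- H0. apply H.
  - intros m Hm. specialize (HS m Hm). specialize (H (npair x m)).
    destruct (P (npair x m)) as [|k]; [easy|eauto].
Qed.

(** The least zero is chosen classically, and it is exactly what [cMu] computes. *)
Lemma ct_search P :
  code_total P -> (forall x, exists n, P (npair x n) = 0) ->
  exists m, code_total m /\ forall x, P (npair x (m x)) = 0.
Proof.
  intros [c Hc] H.
  assert (L : forall x, exists n, P (npair x n) = 0 /\ forall m, m < n -> P (npair x m) <> 0)
    by (intros x; apply (least_nat (fun n => P (npair x n) = 0)), H).
  exists (fun x => proj1_sig (constructive_indefinite_description _ (L x))). split.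
  - exists (cMu c). intros x.
    destruct (constructive_indefinite_description _ (L x)) as (n & H0 & HS). simpl.
    now apply eval_mu_total with P.
  - intros x. now destruct (constructive_indefinite_description _ (L x)) as (n & H0 & HS).
Qed.

(** * Complexity relative to an optimal function *)

Lemma K_spec {D : Type} (U : list bool -> option D) d :
  Kdefined U d -> isK U d (K U d).
Proof.
  intros [p Hp]. unfold K. destruct (excluded_middle_informative _) as [H|H].
  - now destruct (constructive_indefinite_description _ H).
  - exfalso. apply H.
    destruct (least_nat (fun n => exists p, U p = Some d /\ length p = n)) as (n & Hn & L);
      [eauto|].
    exists n. split; [exact Hn|]. intros q Hq.
    destruct (le_lt_dec n (length q)) as [|Hlt]; auto. elim (L _ Hlt). eauto.
Qed.

Lemma K_le_length {D : Type} (U : list bool -> option D) p d :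
  U p = Some d -> K U d <= length p.
Proof. intros H. apply K_spec; [now exists p|exact H]. Qed.

Lemma optimal_bound {D : Type} (C : (list bool -> option D) -> Prop) U psi :
  optimal C U -> C psi ->
  exists c, forall p d, psi p = Some d -> Kdefined U d /\ K U d <= length p + c.
Proof.
  intros [_ H] Hpsi. destruct (H psi Hpsi) as [c Hc]. exists c. intros p d Hp.
  destruct (Hc d (ex_intro _ p Hp)) as [H1 H2]. split; auto.
  apply K_le_length in Hp. lia.
Qed.

Lemma optimal_le_ct {D : Type} (C : (list bool -> option D) -> Prop) U U' :
  optimal C U -> C U' -> (forall d, Kdefined U' d) -> le_ct (K U) (K U').
Proof.
  intros HU HU' T. destruct (optimal_bound C U U' HU HU') as [c Hc].
  exists c. intros d. destruct (K_spec U' d (T d)) as [(p & Hp & <-) _].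
  now apply Hc.
Qed.

(** * Maxima of computable increasing approximations *)

Section Orders.

Context {D : Type}.
Implicit Types (lt : D -> D -> Prop) (rho : nat -> D).

Lemma pc_fun_const rho d : bij_nat rho -> pc_fun rho (fun _ => Some d).
Proof.
  intros [_ Hs]. destruct (Hs d) as [n <-]. exists (fun _ => Some n). split; auto.
  apply (total_computable_code (fun _ => n)), ct_const.
Qed.

Lemma pc_fun_MaxPR lt rho phi : pc_fun rho phi -> MaxPR lt rho phi.
Proof.
  intros (g & Hg & E). exists (fun p _ => phi p). repeat split.
  - exists (fun z => g (nfst z)). split.
    + apply pc_nat_comp; auto using ct_nfst, ct_id.
    + intros p t. now rewrite nfst_npair.
  - intros p t t' x x' _ H H'. left. congruence.
  - exists [d]. intros x [_ Hx]. left. congruence.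
  - exact 0.
  - assumption.
  - intros x [_ Hx]. left. congruence.
  - now intros (_ & [_ H'] & _).
Qed.

(** Each constant function lies in [C], so an optimal function has to describe every [d]. This rules
    out the default value of [K]. *)
Lemma optimal_total (C : (list bool -> option D) -> Prop) rho U :
  bij_nat rho -> (forall psi, pc_fun rho psi -> C psi) -> optimal C U ->
  forall d, Kdefined U d.
Proof.
  intros Hb Hsub HU d.
  destruct (optimal_bound C U (fun _ => Some d) HU) as [c Hc].
  - apply Hsub. now apply pc_fun_const.
  - now apply (Hc []).
Qed.

Lemma leD_antisym lt x y : strict_po lt -> leD lt x y -> leD lt y x -> x = y.
Proof. intros [I T] [|H] [|H']; auto. elim (I x). eauto. Qed.

Lemma leD_trans lt x y z : strict_po lt -> leD lt x y -> leD lt y z -> leD lt x z.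
Proof. intros [I T] [->|H] [<-|H']; unfold leD; eauto. Qed.

(** The relation [is_maxD] is single-valued by antisymmetry, so classical choice turns it into a
    partial function. *)
Lemma max_MaxPR lt rho f :
  strict_po lt -> pc_fun2 rho f -> monotone2 lt f ->
  exists psi, MaxPR lt rho psi /\ forall p d, psi p = Some d <-> is_maxD lt f p d.
Proof.
  intros Hpo Hf Hm.
  enough (exists psi, forall p d, psi p = Some d <-> is_maxD lt f p d) as [psi H].
  { exists psi. split; auto. now exists f. }
  exists (fun p => match excluded_middle_informative (exists d, is_maxD lt f p d) with
    | left H => Some (proj1_sig (constructive_indefinite_description _ H))
    | right _ => None end).
  intros p d. destruct (excluded_middle_informative _) as [H|H].
  - destruct (constructive_indefinite_description _ H) as [d' Hd']. simpl. split.
    + now injection 1 as <-.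
    + intros Hd. f_equal. apply (leD_antisym lt); auto.
      * apply Hd. apply Hd'.
      * apply Hd'. apply Hd.
  - split; [discriminate|]. intros Hd. elim H. eauto.
Qed.

Lemma computable_poset_code lt rho :
  computable_poset lt rho ->
  exists chi, code_total chi /\ forall m n, chi (npair m n) = 1 <-> lt (rho m) (rho n).
Proof.
  intros (_ & _ & chi & Hc & H & _). exists chi. split; auto. now apply total_computable_code.
Qed.

Lemma computable_poset_flip lt rho :
  computable_poset lt rho -> computable_poset (fun x y => lt y x) rho.
Proof.
  intros ((I & T) & Hb & chi & Hc & H & H01). split; [|split]; auto.
  - split; eauto.
  - apply total_computable_code in Hc.
    exists (fun z => chi (npair (nsnd z) (nfst z))). repeat split.
    + apply total_computable_code. ct.
    + rewrite nfst_npair, nsnd_npair. apply H.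
    + rewrite nfst_npair, nsnd_npair. apply H.
    + auto.
Qed.

(* [0] stands for "no value yet" and [S y] for the current lower estimate [rho y]. *)
Lemma MaxPR_approx lt rho U :
  computable_poset lt rho -> MaxPR lt rho U ->
  exists M, code_total M /\
    (forall p s y, M (npair p s) = S y ->
       exists y', M (npair p (S s)) = S y' /\ leD lt (rho y) (rho y')) /\
    (forall p y, U p = Some (rho y) -> eventually (fun s => M (npair (bcode p) s) = S y)).
Proof.
  intros HD (f & (g & [c Hc] & Hf) & _ & HU).
  destruct (computable_poset_code lt rho HD) as (chi & Tchi & Hchi).
  destruct HD as (Hpo & [Inj _] & _).
  destruct (step_approx_exists c) as (st & Tst & Sst & Cst).
  (* Dovetailing: stage [s] codes an argument [nfst s] and a budget [nsnd s]. A value found replaces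
     the estimate only if it lies strictly above it. *)
  pose (upd := fun p s r => ncase (st (npair (npair p (nfst s)) (nsnd s))) r
                 (fun y' => ncase r (S y') (fun y =>
                    if Nat.eqb (chi (npair y y')) 1 then S y' else S y))).
  pose (M := fun z => nat_rect (fun _ => nat) 0 (upd (nfst z)) (nsnd z)).
  assert (MS : forall p s, M (npair p (S s)) = upd p s (M (npair p s))).
  { intros p s. unfold M. now rewrite !nfst_npair, !nsnd_npair. }
  assert (step : forall p s y, M (npair p s) = S y ->
       exists y', M (npair p (S s)) = S y' /\ leD lt (rho y) (rho y')).
  { intros p s y E. rewrite MS, E. unfold upd.
    destruct (st _) as [|y']; simpl; [eexists; split; [eauto|now left]|].
    destruct (Nat.eqb_spec (chi (npair y y')) 1) as [Hlt|_].
    - exists y'. split; auto. right. now apply Hchi.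
    - exists y. split; auto. now left. }
  exists M. split; [|split]; auto.
  - unfold M, upd. ct.
  - intros p y Hp. apply HU in Hp. destruct Hp as (_ & [t Ht] & Hmax).
    (* Every estimate is a value of [f] at the given program, hence never exceeds the maximum
       [rho y]. *)
    assert (val : forall s y', M (npair (bcode p) s) = S y' -> exists t, f p t = Some (rho y')).
    { induction s as [|s IH]; intros y'.
      - unfold M. rewrite nsnd_npair. discriminate.
      - rewrite MS. unfold upd.
        destruct (st _) as [|v] eqn:Ev; simpl; [apply IH|].
        assert (Hv : exists t, f p t = Some (rho v)).
        { exists (nfst s). apply Sst, Hc in Ev. now rewrite Hf, Ev. }
        destruct (M (npair (bcode p) s)) as [|w]; simpl; [now injection 1 as <-|].
        destruct (Nat.eqb _ _); injection 1 as <-; auto. }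
    assert (top : forall s y', M (npair (bcode p) s) = S y' -> leD lt (rho y) (rho y') -> y' = y).
    { intros s y' E Hle. apply Inj, (leD_antisym lt); auto. apply Hmax. eapply val, E. }
    rewrite Hf in Ht. destruct (g _) as [y0|] eqn:Eg; [|discriminate].
    simpl in Ht. injection Ht as Ht. apply Inj in Ht. subst y0.
    apply Hc, Cst in Eg. destruct Eg as [u Hu]. specialize (Hu u (le_n _)).
    (* Stage [npair t u] has enough budget to see the maximum at argument [t]. It is comparable with
       the current estimate [w], so it either equals it or replaces it, and nothing can replace it
       later. *)
    exists (S (npair t u)). induction 1 as [|s _ IH].
    + rewrite MS. unfold upd. rewrite nfst_npair, nsnd_npair, Hu. simpl.
      destruct (M (npair (bcode p) (npair t u))) as [|w] eqn:Ew; simpl; auto.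
      destruct (Nat.eqb_spec (chi (npair w y)) 1) as [_|N]; auto.
      f_equal. apply (top _ _ Ew).
      destruct (Hmax (rho w) (val _ _ Ew)) as [->|Hlt]; [now left|].
      elim N. now apply Hchi.
    + destruct (step _ _ _ IH) as (y' & E & Hle). rewrite E. f_equal. eapply top; eauto.
Qed.

(** * Orders with bounded chains *)

Definition chain lt (l : list D) : Prop :=
  NoDup l /\ forall x y, In x l -> In y l -> leD lt x y \/ lt y x.

Lemma chain_cons_top lt x l :
  strict_po lt -> chain lt l -> (forall y, In y l -> lt y x) -> chain lt (x :: l).
Proof.
  intros [I _] [N C] H. split.
  - constructor; auto. intros Hx. apply (I x), H, Hx.
  - intros a b [<-|Ha] [<-|Hb]; auto.
    + now left; left.
    + left. right. auto.
Qed.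

Lemma chain_firstn lt k l : chain lt l -> chain lt (firstn k l).
Proof.
  intros [N C].
  assert (Sub : forall x, In x (firstn k l) -> In x l).
  { intros x Hx. rewrite <- (firstn_skipn k l). apply in_or_app. now left. }
  split; auto. rewrite <- (firstn_skipn k l) in N. now apply NoDup_app_remove_r in N.
Qed.

(** Without a common bound there are chains of length at least [k] for each [k], and such a chain
    can be cut down to exactly [k] elements. *)
Lemma bounded_chains lt :
  ~ arb_large_chains lt -> exists k, forall l, chain lt l -> length l < k.
Proof.
  intros H.
  destruct (excluded_middle_informative (exists k, forall l, chain lt l -> length l < k))
    as [|N]; auto.
  elim H. intros k.
  destruct (excluded_middle_informative (exists l, chain lt l /\ k <= length l))
    as [(l & Hl & Hk)|N'].
  - exists (firstn k l). split; [rewrite length_firstn; lia|]. now apply chain_firstn.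
  - elim N. exists k. intros l Hl. destruct (le_lt_dec k (length l)); auto. elim N'. eauto.
Qed.

Lemma bounded_chains_le_ct lt rho phi U :
  computable_poset lt rho -> ~ arb_large_chains lt ->
  optimal (pc_fun rho) phi -> MaxPR lt rho U -> (forall d, Kdefined U d) ->
  le_ct (K phi) (K U).
Proof.
  intros HD Hch Hphi HU Tot.
  destruct (bounded_chains lt Hch) as [k Hk].
  destruct (MaxPR_approx lt rho U HD HU) as (M & TM & step & lim).
  destruct HD as (Hpo & [Inj Surj] & _).
  (* [C (npair p s)] counts the changes of the estimate for [p] up to stage [s], the appearance of
     the first value included. *)
  pose (C := fun z => nat_rect (fun _ => nat) 0
     (fun s r => if Nat.eqb (M (npair (nfst z) s)) (M (npair (nfst z) (S s))) then r else S r)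
     (nsnd z)).
  assert (CS : forall p s, C (npair p (S s)) =
     if Nat.eqb (M (npair p s)) (M (npair p (S s))) then C (npair p s) else S (C (npair p s))).
  { intros p s. unfold C. now rewrite !nfst_npair, !nsnd_npair. }
  assert (TC : code_total C) by (unfold C; ct).
  assert (Cbound : forall p s, C (npair p s) < k).
  { intros p s.
    (* The list holds all values shown so far. Each change puts a strictly larger value on top, so
       it remains a chain. *)
    enough (exists l, length l = C (npair p s) /\ chain lt l /\
              forall x, In x l -> exists y, M (npair p s) = S y /\ leD lt x (rho y))
      as (l & <- & Hl & _) by auto.
    induction s as [|s (l & Hlen & Hl & Hle)].
    - exists []. unfold C. rewrite nsnd_npair. repeat split; try constructor; easy.
    - rewrite CS. destruct (Nat.eqb_spec (M (npair p s)) (M (npair p (S s)))) as [E|N].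
      + exists l. rewrite <- E. auto.
      + destruct (M (npair p (S s))) as [|y'] eqn:E'.
        { destruct (M (npair p s)) as [|y] eqn:E; [easy|].
          destruct (step _ _ _ E) as (y' & E'' & _). congruence. }
        assert (Hlt : forall x, In x l -> lt x (rho y')).
        { intros x Hx. destruct (Hle x Hx) as (y & E & Hxy).
          destruct (step _ _ _ E) as (y'' & E'' & Hyy). rewrite E' in E''.
          injection E'' as <-. destruct Hyy as [Eyy|Hyy].
          - apply Inj in Eyy. congruence.
          - destruct Hxy as [->|Hxy]; auto. destruct Hpo as [_ T]. eauto. }
        exists (rho y' :: l). split; [simpl; auto|split].
        * now apply chain_cons_top.
        * intros x [<-|Hx]; exists y'; split; auto; [now left|right; auto]. }
  assert (Cmono : forall p s s', s <= s' ->
            C (npair p s) <= C (npair p s') /\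
            (C (npair p s) = C (npair p s') -> M (npair p s) = M (npair p s'))).
  { induction 1 as [|s' _ [IH1 IH2]]; [auto|]. rewrite CS.
    destruct (Nat.eqb_spec (M (npair p s')) (M (npair p (S s')))) as [<-|N].
    - auto.
    - split; [lia|]. intros; lia. }
  (* The function for [j] outputs the estimate at the first stage with [j] changes. When [j] is the
     final count, [Cmono] shows that this estimate is already the limit. *)
  assert (Hpsi : forall j, exists psi, pc_fun rho psi /\ forall p y s,
            (forall s', s <= s' -> M (npair (bcode p) s') = S y) ->
            C (npair (bcode p) s) = j -> psi p = Some (rho y)).
  { intros j.
    assert (TP : code_total (fun z => if Nat.eqb (C z) j then 0 else 1)) by ct.
    assert (TM' : code_total (fun z => pred (M z))) by ct.
    destruct TP as [cP HP], TM' as [cM HM].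
    destruct (pc_nat_of_code (cComp cM (cPair cId (cMu cP)))) as [g Hg].
    exists (fun p => option_map rho (g (bcode p))). split.
    - exists g. split; auto. now exists (cComp cM (cPair cId (cMu cP))).
    - intros p y s Hs Hj.
      destruct (least_nat (fun s => C (npair (bcode p) s) = j)) as (s1 & H1 & L); [eauto|].
      assert (Hle : s1 <= s).
      { destruct (le_lt_dec s1 s) as [|Hlt]; auto. elim (L s Hlt Hj). }
      assert (E : eval (cComp cM (cPair cId (cMu cP))) (bcode p) y).
      { apply ev_comp with (npair (bcode p) s1).
        - constructor; [constructor|].
          apply eval_mu_total with (fun z => if Nat.eqb (C z) j then 0 else 1); auto.
          + now rewrite H1, Nat.eqb_refl.
          + intros m Hm. destruct (Nat.eqb_spec (C (npair (bcode p) m)) j); [|lia].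
            now elim (L m Hm).
        - replace y with (pred (M (npair (bcode p) s1))); [apply HM|].
          destruct (Cmono (bcode p) s1 s Hle) as [_ ->]; [|congruence].
          now rewrite Hs. }
      apply Hg in E. now rewrite E. }
  (* The constants for the counts below [n] are added up, which gives one constant for all
     programs. *)
  assert (Hc : forall n, exists c, forall p y s, C (npair (bcode p) s) < n ->
            (forall s', s <= s' -> M (npair (bcode p) s') = S y) ->
            K phi (rho y) <= length p + c).
  { induction n as [|n [c IH]].
    - exists 0. intros; lia.
    - destruct (Hpsi n) as (psi & Ppsi & Epsi).
      destruct (optimal_bound _ phi psi Hphi Ppsi) as [c' Hc'].
      exists (c + c'). intros p y s Hlt Hs.
      destruct (Nat.eq_dec (C (npair (bcode p) s)) n) as [E|N].
      + destruct (Hc' p (rho y)) as [_ Hle]; [eauto|lia].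
      + specialize (IH p y s ltac:(lia) Hs). lia. }
  destruct (Hc k) as [c Hk']. exists c. intros d. destruct (Surj d) as [y <-].
  destruct (K_spec U _ (Tot (rho y))) as [(p & Hp & <-) _].
  destruct (lim p y Hp) as [s Hs]. eauto.
Qed.

(** * Long descending chains as a computable family *)

Lemma chain_sort lt l :
  strict_po lt -> chain lt l ->
  exists l', length l' = length l /\ (forall x, In x l' <-> In x l) /\
    forall i x y, nth_error l' i = Some x -> nth_error l' (S i) = Some y -> lt y x.
Proof.
  intros [Irr T]. induction l as [|a l IH]; intros [ND C].
  { exists []. repeat split; auto. now intros [|i]. }
  apply NoDup_cons_iff in ND. destruct ND as [Ha ND].
  destruct IH as (l' & Hlen & Hin & Hs).
  { split; auto. intros; apply C; now right. }
  assert (Ca : forall x, In x l' -> lt a x \/ lt x a).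
  { intros x Hx. apply Hin in Hx.
    destruct (C a x (or_introl eq_refl) (or_intror Hx)) as [[<-|]|]; auto. easy. }
  (* Insertion of [a] into the sorted list. The last clause, on the head of the result, serves the
     induction: it shows that [b] may be put back in front. *)
  assert (exists l'', length l'' = S (length l') /\ (forall x, In x l'' <-> x = a \/ In x l') /\
    (forall i x y, nth_error l'' i = Some x -> nth_error l'' (S i) = Some y -> lt y x) /\
    (forall x, nth_error l'' 0 = Some x -> x = a \/ nth_error l' 0 = Some x))
    as (l'' & H1 & H2 & H3 & _).
  { clear - T Hs Ca. induction l' as [|b l' IH].
    - exists [a]. simpl. repeat split; intros; try (firstorder congruence).
      + destruct i; [discriminate|destruct i; discriminate].
    - destruct (Ca b (or_introl eq_refl)) as [Hab|Hba].
      + destruct IH as (l'' & H1 & H2 & H3 & H4).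
        { intros i. apply (Hs (S i)). }
        { intros x Hx. apply Ca. now right. }
        exists (b :: l''). repeat split.
        * simpl. congruence.
        * intros [<-|Hx]; [now right; left|]. apply H2 in Hx. simpl. tauto.
        * intros [->|[<-|Hx]]; simpl; auto; right; apply H2; auto.
        * intros [|i] x y; simpl; [injection 1 as <-|apply (H3 i)].
          intros Hy. destruct (H4 y Hy) as [->|Hy']; auto. now apply (Hs 0).
        * simpl. intros x. injection 1 as <-. now right.
      + exists (a :: b :: l'). repeat split.
        * intros [<-|Hx]; auto.
        * intros [->|Hx]; [now left|now right].
        * intros [|i] x y; simpl; [|apply (Hs i)].
          injection 1 as <-. now injection 1 as <-.
        * simpl. intros x. injection 1 as <-. now left. }
  exists l''. split; [simpl; congruence|split; auto].
  intros x. rewrite H2, Hin. simpl. intuition.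
Qed.

(** Every number is read as an infinite sequence, with [nfst] as head and [nsnd] as tail, so finite
    lists are coded without a length. *)
Definition nseq (z i : nat) : nat := nfst (nat_rect (fun _ => nat) z (fun _ r => nsnd r) i).

Lemma nseq_0 a z : nseq (npair a z) 0 = a.
Proof. apply nfst_npair. Qed.

Lemma nseq_S a z i : nseq (npair a z) (S i) = nseq z i.
Proof.
  unfold nseq. f_equal. induction i as [|i IH]; simpl in *.
  - apply nsnd_npair.
  - now rewrite IH.
Qed.

Lemma nseq_surj (l : list nat) :
  exists z, forall i a, nth_error l i = Some a -> nseq z i = a.
Proof.
  induction l as [|a l [z IH]].
  - exists 0. now intros [|i].
  - exists (npair a z). intros [|i] b; simpl.
    + injection 1 as <-. apply nseq_0.
    + rewrite nseq_S. apply IH.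
Qed.

(** Whether [z] codes [n] descents is decidable through [chi], so a chain can be searched for;
    arbitrarily long chains make the search terminate. *)
Lemma descending_chains_code lt rho :
  computable_poset lt rho -> arb_large_chains lt ->
  exists z, code_total z /\
    forall n i, i < n -> lt (rho (nseq (z n) (S i))) (rho (nseq (z n) i)).
Proof.
  intros HD Hch. destruct (computable_poset_code lt rho HD) as (chi & Tchi & Hchi).
  destruct HD as (Hpo & [_ Surj] & _).
  pose (P := fun u => nat_rect (fun _ => nat) 0
     (fun i r => if Nat.eqb (chi (npair (nseq (nsnd u) (S i)) (nseq (nsnd u) i))) 1 then r else 1)
     (nfst u)).
  assert (HP : forall n z, P (npair n z) = 0 <->
     forall i, i < n -> lt (rho (nseq z (S i))) (rho (nseq z i))).
  { intros n z. unfold P. rewrite nfst_npair, nsnd_npair.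
    induction n as [|n IH]; simpl; [split; intros; [lia|auto]|].
    destruct (Nat.eqb_spec (chi (npair (nseq z (S n)) (nseq z n))) 1) as [E|N].
    - rewrite IH. split; intros H i Hi; [|apply H; lia].
      destruct (Nat.eq_dec i n) as [->|]; [now apply Hchi|apply H; lia].
    - split; [discriminate|]. intros H. elim N. apply Hchi, H. lia. }
  assert (TP : code_total P) by (unfold P, nseq; ct).
  destruct (ct_search P TP) as (z & Tz & Hz).
  (* A sequence of [n] descents has [S n] elements. *)
  - intros n. destruct (Hch (S n)) as (l & Hlen & Hl).
    destruct (chain_sort lt l Hpo Hl) as (l' & Hlen' & _ & Hs).
    assert (exists m, map rho m = l') as [m Hm].
    { clear - Surj. induction l' as [|d l' [m IH]]; [now exists []|].
      destruct (Surj d) as [a Ha]. exists (a :: m). simpl. congruence. }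
    destruct (nseq_surj m) as [z Hz]. exists z. apply HP. intros i Hi.
    assert (G : forall j, j < S n -> nth_error l' j = Some (rho (nseq z j))).
    { intros j Hj. subst l'. rewrite length_map in Hlen'. rewrite nth_error_map.
      destruct (nth_error m j) as [a|] eqn:E.
      - simpl. now rewrite (Hz _ _ E).
      - apply nth_error_None in E. lia. }
    apply (Hs i); apply G; lia.
  - exists z. split; auto. intros n. now apply HP.
Qed.

(** * Numbering of programs and majorants *)

Lemma bcode_surj n : exists p, bcode p = n.
Proof.
  induction n as [n IH] using lt_wf_ind. destruct n as [|n]; [now exists []|].
  destruct (IH (n / 2)) as [p Hp].
  { pose proof (Nat.Div0.div_le_upper_bound n 2 n). lia. }
  exists ((n mod 2 =? 1) :: p). cbn [bcode]. rewrite Hp.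
  pose proof (Nat.div_mod_eq n 2). pose proof (Nat.mod_upper_bound n 2).
  destruct (Nat.eqb_spec (n mod 2) 1); lia.
Qed.

Lemma length_le_bcode p : length p <= bcode p.
Proof. induction p; simpl; lia. Qed.

(** Only an upper bound on [K Umin d] will be known, so [alpha] is replaced by a function dominating
    all its earlier values. The clause [m < A m] later makes the elements found leave any finite
    list. *)
Lemma code_total_majorant alpha :
  code_total alpha -> exists A, code_total A /\
    (forall m, m < A m) /\ forall i m, i <= m -> alpha i <= A m.
Proof.
  intros Ta.
  pose (A := fun m => nat_rect (fun _ => nat) (S (alpha 0)) (fun m r => S (r + alpha (S m))) m).
  assert (AS : forall m, A (S m) = S (A m + alpha (S m))) by reflexivity.
  exists A. split; [unfold A; ct|]. split.
  - induction m as [|m IH]; [unfold A; simpl; lia|]. rewrite AS. lia.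
  - induction 1 as [|m _ IH].
    + destruct i; [unfold A; simpl; lia|]. rewrite AS. lia.
    + rewrite AS. lia.
Qed.

Lemma bcode_bound : exists h, code_total h /\ forall l p, length p < l -> bcode p < h l.
Proof.
  (* The recursion computes 2^(l+1) - 2, which is at least the number 2^l - 1 of programs shorter
     than [l]. *)
  exists (fun l => nat_rect (fun _ => nat) 0 (fun _ r => S (S (r + r))) l). split; [ct|].
  induction l as [|l IH]; intros p Hp; [lia|].
  destruct p as [|b p]; simpl in *; [lia|].
  specialize (IH p ltac:(lia)). destruct b; lia.
Qed.

(** * The walk down a chain and the gap between the two complexities *)

Lemma eventually_constant_of_bounded (I : nat -> nat) N :
  (forall s, I s <= I (S s)) -> (forall s, I s <= N) ->
  exists i s0, forall s, s0 <= s -> I s = i.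
Proof.
  intros Hm Hb.
  (* From a stage that minimizes [N - I s] on, [I] cannot grow any more. *)
  destruct (least_nat (fun k => exists s, N - I s = k)) as (k & [s0 Hs0] & L);
    [now exists (N - I 0), 0|].
  exists (I s0), s0. induction 1 as [|s _ IH]; auto.
  specialize (Hm s). pose proof (Hb (S s)).
  destruct (Nat.eq_dec (I (S s)) (I s)) as [|N']; [congruence|].
  elim (L (N - I (S s))); [lia|eauto].
Qed.

(* The candidate [nseq z (I s)] moves one step down the chain whenever some program [q < N]
   currently points at it. An approximation only increases, so [q] stays strictly above all
   later candidates: each program causes at most one move. *)
Lemma candidate_moves_bounded lt rho (M : nat -> nat) (I : nat -> nat) z N :
  strict_po lt ->
  (forall p s y, M (npair p s) = S y ->
     exists y', M (npair p (S s)) = S y' /\ leD lt (rho y) (rho y')) ->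
  (forall i, i < N -> lt (rho (nseq z (S i))) (rho (nseq z i))) ->
  I 0 = 0 ->
  (forall s, I (S s) = I s \/
     I (S s) = S (I s) /\ exists q, q < N /\ M (npair q s) = S (nseq z (I s))) ->
  forall s, I s <= N.
Proof.
  intros [Irr T] step desc I0 IS s.
  (* [l] lists the programs that have caused a move. A program causing a new one points at the
     candidate itself, not strictly above it, hence is not yet in [l]. *)
  enough (exists l, length l = I s /\ NoDup l /\
     forall q, In q l -> q < N /\ exists y, M (npair q s) = S y /\
        lt (rho (nseq z (I s))) (rho y)) as (l & <- & ND & H).
  { rewrite <- (length_seq N 0). apply NoDup_incl_length; auto.
    intros q Hq. apply in_seq. destruct (H q Hq). lia. }
  induction s as [|s (l & Hlen & ND & H)].
  - exists []. repeat split; [now rewrite I0|constructor|easy|easy].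
  - assert (H' : forall q y, M (npair q s) = S y -> forall e, lt e (rho y) ->
              exists y', M (npair q (S s)) = S y' /\ lt e (rho y')).
    { intros q y E e He. destruct (step _ _ _ E) as (y' & E' & Hle).
      exists y'. destruct Hle as [<-|Hlt]; eauto. }
    destruct (IS s) as [E|[E (q0 & Hq0 & E0)]].
    + exists l. rewrite E. repeat split; auto.
      * now apply H.
      * destruct (H q) as (_ & y & Ey & Hy); eauto.
    + assert (ND' : NoDup (q0 :: l)).
      { constructor; auto. intros Hin. destruct (H q0 Hin) as (_ & y & Ey & Hy).
        rewrite E0 in Ey. injection Ey as <-. now apply Irr in Hy. }
      (* Even with [q0] added there are at most [N] programs, so the chain still has a next
         element. *)
      assert (Hlt : I s < N).
      { enough (length (q0 :: l) <= length (seq 0 N)) by (rewrite length_seq in *; simpl in *; lia).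
        apply NoDup_incl_length; auto. intros q [<-|Hq]; apply in_seq; [lia|].
        destruct (H q Hq). lia. }
      exists (q0 :: l). rewrite E. repeat split; auto.
      * simpl. auto.
      * destruct H0 as [<-|Hq]; auto. now apply H.
      * destruct H0 as [<-|Hq]; [eauto|].
        destruct (H q Hq) as (_ & y & Ey & Hy). eauto.
Qed.

Lemma K_gap_infinite lt rho Umax Umin alpha :
  computable_poset lt rho -> arb_large_chains lt ->
  optimal (MaxPR lt rho) Umax -> optimal (MaxPR (fun x y => lt y x) rho) Umin ->
  code_total alpha -> infinite_set (fun d => alpha (K Umin d) <= K Umax d).
Proof.
  intros HD Hch Hmax Hmin Ta.
  destruct (code_total_majorant alpha Ta) as (A & TA & A_gt & A_ge).
  destruct bcode_bound as (h & Th & Hh).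
  destruct (descending_chains_code lt rho HD Hch) as (z & Tz & desc).
  destruct (MaxPR_approx lt rho Umax HD (proj1 Hmax)) as (M & TM & step & lim).
  pose proof (proj1 (proj2 HD)) as [Inj Surj].
  assert (TotMax : forall d, Kdefined Umax d)
    by (eapply optimal_total; [exact (conj Inj Surj)|apply pc_fun_MaxPR|exact Hmax]).
  pose proof (proj1 HD) as Hpo.
  (* [N n] exceeds the code of every program of length below [A (n + n)], so it bounds the number of
     moves. *)
  pose (N := fun n => h (A (n + n))).
  assert (TN : code_total N) by (unfold N; ct).
  pose (e := fun n i => nseq (z (N n)) i).
  pose (hit := fun n s i => nat_rect (fun _ => nat) 0
     (fun q r => if Nat.eqb (M (npair q s)) (S (e n i)) then 1 else r) (N n)).
  assert (hit_spec : forall n s i,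
     (hit n s i = 0 /\ forall q, q < N n -> M (npair q s) <> S (e n i)) \/
     (hit n s i = 1 /\ exists q, q < N n /\ M (npair q s) = S (e n i))).
  { intros n s i. unfold hit. induction (N n) as [|m IH]; simpl; [left; split; auto; lia|].
    destruct (Nat.eqb_spec (M (npair m s)) (S (e n i))) as [E|NE].
    - right. split; auto. exists m. auto.
    - destruct IH as [[-> IH]|[-> (q & Hq & E)]].
      + left. split; auto. intros q Hq. destruct (Nat.eq_dec q m) as [->|]; auto.
        apply IH. lia.
      + right. split; auto. exists q. auto. }
  pose (I := fun u => nat_rect (fun _ => nat) 0 (fun s i => i + hit (nfst u) s i) (nsnd u)).
  assert (TI : code_total I) by (unfold I, hit, e, nseq; ct).
  assert (IS : forall n s, I (npair n (S s)) = I (npair n s) + hit n s (I (npair n s))).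
  { intros n s. unfold I. now rewrite !nsnd_npair, !nfst_npair. }
  assert (Ibound : forall n s, I (npair n s) <= N n).
  { intros n. apply (candidate_moves_bounded lt rho M (fun s => I (npair n s)) (z (N n))); auto.
    - unfold I. now rewrite nsnd_npair.
    - intros s. rewrite IS.
      destruct (hit_spec n s (I (npair n s))) as [[-> _]|[-> H]]; [left|right; split; auto]; lia. }
  assert (Imono : forall n s s', s <= s' -> I (npair n s) <= I (npair n s')).
  { induction 1; [auto|]. rewrite IS. lia. }
  assert (Ianti : forall n i j, i <= j -> j <= N n -> leD lt (rho (e n j)) (rho (e n i))).
  { intros n. induction 1 as [|j Hij IH]; intros Hj; [now left|].
    apply leD_trans with (rho (e n j)); auto; [right; apply desc; lia|apply IH; lia]. }
  (* The program matters only through its code [n]. The positions [I] increase with [t], so the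
     values descend in [lt], as the reverse order requires. *)
  pose (f := fun p t => Some (rho (e (bcode p) (I (npair (bcode p) t))))).
  destruct (max_MaxPR (fun x y => lt y x) rho f) as (psi & Hpsi & psi_spec).
  { apply (computable_poset_flip lt rho HD). }
  { exists (fun u => Some (e (nfst u) (I u))). split.
    - apply total_computable_code. unfold e, nseq. ct.
    - intros p t. now rewrite nfst_npair. }
  { intros p t t' x x' Ht H H'. injection H as <-. injection H' as <-.
    destruct (Ianti (bcode p) _ _ (Imono (bcode p) t t' Ht) (Ibound _ _)) as [<-|H];
      [now left|now right]. }
  destruct (optimal_bound _ Umin psi Hmin Hpsi) as [c Hc].
  assert (key : forall n, c <= n -> exists d, A (n + n) <= K Umax d /\ K Umin d <= n + n).
  { intros n Hn.
    destruct (eventually_constant_of_bounded (fun s => I (npair n s)) (N n))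
      as (i & s0 & Hi); auto.
    exists (rho (e n i)). split.
    - destruct (K_spec Umax _ (TotMax (rho (e n i)))) as [(p & Hp & <-) _].
      (* A program shorter than [A (n + n)] for the final candidate would eventually point at it and
         force one more move. *)
      destruct (le_lt_dec (A (n + n)) (length p)) as [|Hlt]; auto. exfalso.
      destruct (lim p _ Hp) as [s1 Hs1].
      pose proof (Hi (s0 + s1) ltac:(lia)) as E1.
      pose proof (Hi (S (s0 + s1)) ltac:(lia)) as E2.
      cbv beta in E1, E2. rewrite IS, E1 in E2.
      destruct (hit_spec n (s0 + s1) i) as [[_ H]|[H _]]; [|lia].
      apply (H (bcode p)); [now apply Hh|apply Hs1; lia].
    - destruct (bcode_surj n) as [p Hp].
      assert (E : psi p = Some (rho (e n i))).
      { apply psi_spec. unfold is_maxD, f. rewrite Hp. repeat split.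
        - exists (map (fun j => rho (e n j)) (seq 0 (S (N n)))).
          intros x [t Ht]. injection Ht as <-.
          apply (in_map (fun j => rho (e n j))), in_seq. specialize (Ibound n t). lia.
        - exists s0. now rewrite Hi.
        - intros x [t Ht]. injection Ht as <-.
          (* Stage [s0 + t] lies beyond both the stabilization stage and [t]. *)
          rewrite <- (Hi (s0 + t)) by lia.
          destruct (Ianti n (I (npair n t)) (I (npair n (s0 + t)))) as [<-|H]; auto;
            [apply Imono; lia|now left|now right]. }
      destruct (Hc p _ E) as [_ Hle]. pose proof (length_le_bcode p). lia. }
  intros l.
  assert (exists b, forall d, In d l -> K Umax d <= b) as [b Hb].
  { clear. induction l as [|d l [b IH]]; [now exists 0|].
    exists (K Umax d + b). intros d' [<-|Hd]; [lia|]. specialize (IH d' Hd). lia. }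
  (* With [n = c + b], [K Umax d] is at least [A (n + n)], which exceeds the bound [b] valid on
     [l]. *)
  destruct (key (c + b)) as (d & H1 & H2); [lia|].
  exists d. split.
  - pose proof (A_ge _ _ H2). lia.
  - intros Hd. specialize (Hb d Hd). pose proof (A_gt (c + b + (c + b))). lia.
Qed.

(** * From gaps to incomparability *)

Lemma infinite_set_impl (P Q : D -> Prop) :
  (forall d, P d -> Q d) -> infinite_set P -> infinite_set Q.
Proof. intros H HP l. destruct (HP l) as (d & Hd & Hl). eauto. Qed.

(** The additive constant is absorbed by using the gap for [alpha x + c]. *)
Lemma gap_infinite_le_ct (f g g' : D -> nat) :
  le_ct g g' ->
  (forall alpha, code_total alpha -> infinite_set (fun d => alpha (f d) <= g d)) ->
  forall alpha, code_total alpha -> infinite_set (fun d => alpha (f d) <= g' d).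
Proof.
  intros [c Hc] H alpha Ta.
  apply (infinite_set_impl (fun d => alpha (f d) + c <= g d)).
  - intros d Hd. specialize (Hc d). lia.
  - apply (H (fun x => alpha x + c)). ct.
Qed.

(** A gap for [S (x + c)] contradicts the bound with constant [c]. *)
Lemma gap_infinite_not_le_ct (f g : D -> nat) :
  (forall alpha, code_total alpha -> infinite_set (fun d => alpha (f d) <= g d)) ->
  ~ le_ct g f.
Proof.
  intros H [c Hc]. destruct (H (fun x => S (x + c)) ltac:(ct) []) as (d & Hd & _).
  specialize (Hc d). lia.
Qed.

Lemma arb_large_chains_flip lt :
  arb_large_chains lt -> arb_large_chains (fun x y => lt y x).
Proof.
  intros H k. destruct (H k) as (l & Hlen & ND & Hl). exists l. repeat split; auto.
  intros x y Hx Hy. destruct (Hl x y Hx Hy) as [[->|]|]; unfold leD; auto.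
Qed.

End Orders.

Theorem mainTheorem2 (D : Type) (lt : D -> D -> Prop) (rho : nat -> D)
  (HD : computable_poset lt rho)
  (phi Umax Umin : list bool -> option D)
  (Hphi : optimal (pc_fun rho) phi)
  (Hmax : optimal (MaxPR lt rho) Umax)
  (Hmin : optimal (MaxPR (fun x y => lt y x) rho) Umin) :
  (arb_large_chains lt ->
     (~ le_ct (K Umax) (K Umin) /\ ~ le_ct (K Umin) (K Umax) /\
      lt_ct (K Umax) (K phi) /\ lt_ct (K Umin) (K phi)) /\
     (forall alpha : nat -> nat, total_computable alpha ->
        infinite_set (fun d => alpha (K Umin d) <= K Umax d) /\
        infinite_set (fun d => alpha (K Umin d) <= K phi d) /\
        infinite_set (fun d => alpha (K Umax d) <= K Umin d) /\
        infinite_set (fun d => alpha (K Umax d) <= K phi d))) /\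
  (~ arb_large_chains lt ->
     eq_ct (K Umin) (K Umax) /\ eq_ct (K Umax) (K phi)).
Proof.
  pose proof (proj1 (proj2 HD)) as Hb.
  pose proof (computable_poset_flip lt rho HD) as HD'.
  assert (Tphi : forall d, Kdefined phi d) by (eapply optimal_total; eauto).
  assert (Tmax : forall d, Kdefined Umax d)
    by (eapply optimal_total; [exact Hb|apply pc_fun_MaxPR|exact Hmax]).
  assert (Tmin : forall d, Kdefined Umin d)
    by (eapply optimal_total; [exact Hb|apply pc_fun_MaxPR|exact Hmin]).
  assert (Lmax : le_ct (K Umax) (K phi))
    by (eapply (optimal_le_ct (MaxPR lt rho)); [exact Hmax|apply pc_fun_MaxPR, Hphi|exact Tphi]).
  assert (Lmin : le_ct (K Umin) (K phi))
    by (eapply (optimal_le_ct (MaxPR _ rho)); [exact Hmin|apply pc_fun_MaxPR, Hphi|exact Tphi]).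
  split; intros Hch.
  - pose proof (fun alpha => K_gap_infinite lt rho Umax Umin alpha HD Hch Hmax Hmin) as G1.
    (* Passing to the reverse order exchanges [Umax] and [Umin]; reversing twice gives [lt] back up
       to conversion. *)
    pose proof (fun alpha => K_gap_infinite _ rho Umin Umax alpha HD'
                  (arb_large_chains_flip lt Hch) Hmin Hmax) as G3.
    pose proof (gap_infinite_le_ct _ _ _ Lmax G1) as G2.
    pose proof (gap_infinite_le_ct _ _ _ Lmin G3) as G4.
    split.
    + repeat split; auto; apply gap_infinite_not_le_ct; auto.
    + intros alpha Ta. apply total_computable_code in Ta. auto.
  - assert (Hch' : ~ arb_large_chains (fun x y => lt y x))
      by (intros H; apply Hch, (arb_large_chains_flip _ H)).
    assert (Rmax : le_ct (K phi) (K Umax))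
      by (apply (bounded_chains_le_ct lt rho); auto; apply Hmax).
    assert (Rmin : le_ct (K phi) (K Umin))
      by (apply (bounded_chains_le_ct (fun x y => lt y x) rho); auto; apply Hmin).
    assert (Tr : forall f g h : D -> nat, le_ct f g -> le_ct g h -> le_ct f h).
    { intros f g h [c Hc] [c' Hc']. exists (c + c'). intros d.
      specialize (Hc d). specialize (Hc' d). lia. }
    repeat split; eauto.
Qed.
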